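(* Let $\mathbf{z}\in K_{\exp}^*$ with $z_x=z_y=0$ and $z_z>0$, so that $\{\mathbf{z}\}^\perp\cap K_{\exp}=\mathcal{F}_\infty$. Let $\alpha\in(0,1]$ and $\eta>0$. Then $$\inf_{\mathbf{q}}\left\{\frac{\mathrm{d}(\mathbf{q},K_{\exp})^\alpha}{\mathrm{d}(\mathbf{q},\mathcal{F}_\infty)}\;\Big|\;\mathbf{q}\in\{\mathbf{z}\}^\perp\cap B(\eta)\setminus\mathcal{F}_\infty\right\}=0.$$
   Context: $\mathbb{R}^3$ carries the standard inner product and Euclidean norm; vectors are written $\mathbf{p}=(p_x,p_y,p_z)$. $K_{\exp}=\{(x,y,z):y>0,\ z\ge ye^{x/y}\}\cup\{(x,y,z):x\le0,\ z\ge0,\ y=0\}$ is the exponential cone, $K_{\exp}^*$ its dual cone, and $\mathcal{F}_\infty=\{(x,0,0):x\le0\}$. $B(\eta)$ is the closed ball of radius $\eta$ centered at the origin and $\mathrm{d}(\cdot,C)$ is the distance to $C$. *)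

(* Defs.v *)
From HB Require Import structures.
From mathcomp Require Import all_boot all_order all_algebra.
From mathcomp Require Import all_classical all_reals all_analysis.

Set Implicit Arguments.
Unset Strict Implicit.
Unset Printing Implicit Defensive.
Import Order.TTheory GRing.Theory Num.Theory.
Local Open Scope classical_set_scope.
Local Open Scope ring_scope.

(* The library norm `|_| on 'rV[R]_n is the sup norm
   (and so are its balls and distances), hence the Euclidean notions below. *)

Definition dotv (R : realType) (n : nat) (u v : 'rV[R]_n) : R :=
  \sum_(i < n) u 0 i * v 0 i.

Definition enorm (R : realType) (n : nat) (u : 'rV[R]_n) : R :=
  Num.sqrt (dotv u u).

(* Real-valued infimum: meaningful for nonempty C only (inf set0 = 0). *)
Definition eucl_dist (R : realType) (n : nat) (q : 'rV[R]_n) (C : set 'rV[R]_n) : R :=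
  inf [set enorm (q - c) | c in C].

Definition eball0 (R : realType) (n : nat) (eta : R) : set 'rV[R]_n :=
  [set p | enorm p <= eta].

Definition orthogonal_compl (R : realType) (n : nat) (A : set 'rV[R]_n)
  : set 'rV[R]_n := [set p | forall a, A a -> dotv a p = 0].

Definition dual_cone (R : realType) (n : nat) (K : set 'rV[R]_n)
  : set 'rV[R]_n := [set s | forall p, K p -> 0 <= dotv s p].

Definition xc (R : realType) (p : 'rV[R]_3) : R := p 0 (@Ordinal 3 0 isT).
Definition yc (R : realType) (p : 'rV[R]_3) : R := p 0 (@Ordinal 3 1 isT).
Definition zc (R : realType) (p : 'rV[R]_3) : R := p 0 (@Ordinal 3 2 isT).

Definition Kexp (R : realType) : set 'rV[R]_3 :=
  [set p | 0 < yc p /\ yc p * expR (xc p / yc p) <= zc p] `|`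
  [set p | [/\ xc p <= 0, 0 <= zc p & yc p = 0]].

Definition Finfty (R : realType) : set 'rV[R]_3 :=
  [set p | [/\ xc p <= 0, yc p = 0 & zc p = 0]].

(* Main.v *)
(* On the slice [z_z = 0], the points [q = (-a, y, 0)] with [y > 0] are at
   distance at least [y] from the ray, but only [y e^(-a/y)] below the boundary
   of the exponential cone. As [y] tends to [0] this gap is smaller than every
   power of [y], so no Hoelder-type exponent can compensate for it. *)
Require Import Defs.
From HB Require Import structures.
From mathcomp Require Import all_boot all_order all_algebra.
From mathcomp Require Import all_classical all_reals all_analysis.
From mathcomp Require Import ring lra.

Set Implicit Arguments.
Unset Strict Implicit.
Unset Printing Implicit Defensive.
Import Order.TTheory GRing.Theory Num.Theory.
Local Open Scope classical_set_scope.
Local Open Scope ring_scope.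

Definition vec3 (R : realType) (a b c : R) : 'rV[R]_3 :=
  \row_(i < 3) [:: a; b; c]`_i.

Lemma xc_vec3 (R : realType) (a b c : R) : xc (vec3 a b c) = a.
Proof. by rewrite /xc mxE. Qed.

Lemma yc_vec3 (R : realType) (a b c : R) : yc (vec3 a b c) = b.
Proof. by rewrite /yc mxE. Qed.

Lemma zc_vec3 (R : realType) (a b c : R) : zc (vec3 a b c) = c.
Proof. by rewrite /zc mxE. Qed.

Definition vec3E := (xc_vec3, yc_vec3, zc_vec3).

Lemma dotv3E (R : realType) (u v : 'rV[R]_3) :
  dotv u v = xc u * xc v + yc u * yc v + zc u * zc v.
Proof.
rewrite /dotv !big_ord_recr big_ord0 /= add0r.
by congr (u 0 _ * v 0 _ + u 0 _ * v 0 _ + u 0 _ * v 0 _); apply: val_inj.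
Qed.

Lemma enorm3E (R : realType) (u : 'rV[R]_3) :
  enorm u = Num.sqrt (xc u ^+ 2 + yc u ^+ 2 + zc u ^+ 2).
Proof. by rewrite /enorm dotv3E !expr2. Qed.

Lemma enorm_ge_yc (R : realType) (u : 'rV[R]_3) : `|yc u| <= enorm u.
Proof. by rewrite enorm3E -sqrtr_sqr ler_wsqrtr//; nra. Qed.

Section EuclideanDistance.
Context {R : realType} {n : nat}.
Implicit Types (q c : 'rV[R]_n) (C : set 'rV[R]_n).

Lemma eucl_dist_ge0 q C : 0 <= eucl_dist q C.
Proof.
rewrite /eucl_dist; set D := [set _ | _ in _].
(* For empty [C] the real infimum takes its default value 0, which still satisfies the bound. *)
have [->|/set0P D0] := eqVneq D set0; first by rewrite inf0.
by apply: lb_le_inf => // _ [c _ <-]; exact: sqrtr_ge0.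
Qed.

Lemma eucl_dist_le q c C : C c -> eucl_dist q C <= enorm (q - c).
Proof.
move=> Cc; apply: ge_inf; last by exists c.
by exists 0 => _ [d _ <-]; exact: sqrtr_ge0.
Qed.

(** Nonemptiness matters: over the empty set the distance defaults to 0, so a positive [r] would
    fail. *)
Lemma eucl_dist_ge q C (r : R) :
  C !=set0 -> (forall c, C c -> r <= enorm (q - c)) -> r <= eucl_dist q C.
Proof.
move=> [c Cc] rC; apply: lb_le_inf; first by exists (enorm (q - c)), c.
by move=> _ [d Cd <-]; exact: rC.
Qed.

End EuclideanDistance.

(** The competitor is the boundary point of the cone directly above, with the same first two
    coordinates; the difference is purely vertical. *)
Lemma Kexp_dist_le (R : realType) (a y : R) : 0 < y ->
  eucl_dist (vec3 (- a) y 0) (@Kexp R) <= y * expR (- a / y).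
Proof.
move=> y0; set w := y * _.
have w0 : 0 <= w by rewrite mulr_ge0 ?expR_ge0// ltW.
have Kw : Kexp (vec3 (- a) y w) by left; rewrite /= !vec3E.
apply: le_trans (eucl_dist_le _ Kw) _.
rewrite enorm3E.
have -> : xc (vec3 (- a) y 0 - vec3 (- a) y w) = 0.
  by rewrite /xc !mxE subrr.
have -> : yc (vec3 (- a) y 0 - vec3 (- a) y w) = 0.
  by rewrite /yc !mxE subrr.
have -> : zc (vec3 (- a) y 0 - vec3 (- a) y w) = - w.
  by rewrite /zc !mxE sub0r.
by rewrite expr0n !add0r sqrrN sqrtr_sqr ger0_norm.
Qed.

(** Every point of the ray has zero second coordinate, so subtracting it leaves [yc q] unchanged. *)
Lemma Finfty_dist_ge (R : realType) (q : 'rV[R]_3) :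
  yc q <= eucl_dist q (@Finfty R).
Proof.
apply: eucl_dist_ge; first by exists (vec3 0 0 0); rewrite /Finfty/= !vec3E.
move=> c [_ yc0 _]; apply: le_trans (enorm_ge_yc _).
have -> : yc (q - c) = yc q by rewrite -[RHS]subr0 -yc0 /yc !mxE.
exact: ler_norm.
Qed.

(** Squaring [x / 2 <= expR (x / 2)] and inverting gives quadratic decay. Order two suffices later:
    one power of [y] cancels the distance to the ray, the other tends to 0. *)
Lemma expRN_le_inv_sqr (R : realType) (x : R) :
  0 < x -> expR (- x) <= 4 / x ^+ 2.
Proof.
move=> x0; rewrite expRN -[4 / _]invf_div lef_pV2 ?posrE ?expR_gt0//; last first.
  by rewrite divr_gt0// exprn_gt0.
have h : x / 2 <= expR (x / 2) by have := expR_ge1Dx (x / 2); lra.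
have -> : expR x = expR (x / 2) ^+ 2.
  by rewrite expr2 -expRD -splitr.
have : (x / 2) ^+ 2 <= expR (x / 2) ^+ 2.
  by rewrite lerXn2r ?nnegrE ?expR_ge0// divr_ge0// ltW.
by apply: le_trans; lra.
Qed.

Lemma Kexp_Finfty_ratio_le (R : realType) (alpha a y : R) :
  0 < alpha -> 0 < a -> 0 < y -> y <= 1 ->
  eucl_dist (vec3 (- a) y 0) (@Kexp R) `^ alpha
    / eucl_dist (vec3 (- a) y 0) (@Finfty R) <= 4 / (a * alpha) ^+ 2 * y.
Proof.
move=> alpha0 a0 y0 y1; set q := vec3 _ _ _.
have yF : y <= eucl_dist q (@Finfty R).
  by have := Finfty_dist_ge q; rewrite vec3E.
have dK : eucl_dist q (@Kexp R) `^ alpha <= 4 / (a * alpha / y) ^+ 2.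
  apply: (@le_trans _ _ (expR (- a / y) `^ alpha)).
    apply: ge0_ler_powR; rewrite ?nnegrE ?eucl_dist_ge0 ?expR_ge0 ?(ltW alpha0)//.
    apply: le_trans (Kexp_dist_le _ y0) _.
    (* The factor [y] is dropped using [y <= 1], which leaves a pure exponential whose power is
       again an exponential. *)
    by rewrite ler_piMl ?expR_ge0.
  rewrite -expRM.
  have -> : - a / y * alpha = - (a * alpha / y) by field; rewrite gt_eqF.
  by apply: expRN_le_inv_sqr; rewrite divr_gt0 ?mulr_gt0.
apply: (@le_trans _ _ (4 / (a * alpha / y) ^+ 2 / y)).
  apply: ler_pM; rewrite ?powR_ge0 ?invr_ge0 ?eucl_dist_ge0//.
  by rewrite lef_pV2// posrE (lt_le_trans y0).
rewrite le_eqVlt; apply/orP; left; apply/eqP.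
by field; rewrite !gt_eqF.
Qed.

Lemma orthogonal_compl_zaxis (R : realType) (z p : 'rV[R]_3) :
  xc z = 0 -> yc z = 0 -> 0 < zc z ->
  orthogonal_compl [set z] p <-> zc p = 0.
Proof.
move=> zx zy zz; split=> [/(_ z erefl)|zp _ ->].
  rewrite dotv3E zx zy !mul0r !add0r => /eqP.
  by rewrite mulf_eq0 gt_eqF//= => /eqP.
by rewrite dotv3E zx zy zp !mul0r mulr0 !addr0.
Qed.

(** The branch with positive second coordinate forces a positive third one, so only the degenerate
    branch meets the plane. *)
Lemma Kexp_slice (R : realType) (p : 'rV[R]_3) :
  zc p = 0 /\ Kexp p <-> Finfty p.
Proof.
split=> [[zp [[y0]|[xp _ yp]]]|[xp yp zp]].
- by rewrite zp leNgt mulr_gt0 ?expR_gt0.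
- by [].
- by split=> //; right; split; rewrite ?zp.
Qed.

Theorem lemma4p9 (R : realType) (z : 'rV[R]_3)
    (hz : dual_cone (@Kexp R) z) (hzx : xc z = 0) (hzy : yc z = 0)
    (hzz : 0 < zc z) (alpha eta : R)
    (halpha0 : 0 < alpha) (halpha1 : alpha <= 1) (heta : 0 < eta) :
  orthogonal_compl [set z] `&` @Kexp R = @Finfty R /\
  ereal_inf [set ((eucl_dist q (@Kexp R) `^ alpha) / eucl_dist q (@Finfty R))%:E
            | q in (orthogonal_compl [set z] `&` eball0 eta) `\` @Finfty R] = 0%:E.
Proof.
have perpE p := @orthogonal_compl_zaxis R z p hzx hzy hzz.
split.
  apply/seteqP; split=> p.
    by move=> [/perpE zp Kp]; apply/Kexp_slice.
  by move=> /Kexp_slice[zp Kp]; split=> //; apply/perpE.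
apply/eqP; rewrite eq_le; apply/andP; split; last first.
  apply: le_ereal_inf_tmp => _ [q _ <-].
  by rewrite lee_fin divr_ge0 ?powR_ge0 ?eucl_dist_ge0.
(* For the upper bound, it suffices to exhibit for each [e > 0] one admissible point with ratio at
   most [e]. *)
apply/lee_addgt0Pr => e e0; rewrite add0e.
set a := eta / 2; set C := 4 / (a * alpha) ^+ 2.
have a0 : 0 < a by rewrite divr_gt0.
have C0 : 0 < C by rewrite divr_gt0// exprn_gt0// mulr_gt0.
(* The three bounds serve, in turn, to keep [q] in the ball, to apply the ratio estimate, and to
   make that estimate at most [e]. *)
pose y := Num.min a (Num.min 1 (e / C)).
have y0 : 0 < y by rewrite !lt_min a0 ltr01 divr_gt0.
have ya : y <= a by rewrite ge_min lexx.
have y1 : y <= 1 by rewrite !ge_min lexx orbT.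
have Cy : C * y <= e.
  by rewrite mulrC -ler_pdivlMr// !ge_min lexx !orbT.
pose q := vec3 (- a) y 0.
have q_slice : ((orthogonal_compl [set z] `&` eball0 eta) `\` @Finfty R) q.
  split; last by case; rewrite /= !vec3E => _ /eqP; rewrite gt_eqF.
  split; first by apply/perpE; rewrite vec3E.
  rewrite /eball0/= enorm3E !vec3E -[leRHS]gtr0_norm// -sqrtr_sqr ler_wsqrtr//.
  (* Since [0 < y <= a], the squared norm is [a ^+ 2 + y ^+ 2 <= 2 * a ^+ 2], below
     [eta ^+ 2 = 4 * a ^+ 2]. *)
  have -> : eta = 2 * a by rewrite /a mulrC divfK.
  nra.
apply: (@le_trans _ _
    (eucl_dist q (@Kexp R) `^ alpha / eucl_dist q (@Finfty R))%:E).
  by apply: ereal_inf_lbound; exists q.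
by rewrite lee_fin; apply: le_trans Cy; exact: Kexp_Finfty_ratio_le.
Qed.
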